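(* Let $n\ge1$ be an integer and $\alpha\in(0,1)$. Let $u:\mathbb{R}^n\to\mathbb{R}$ be a (measurable) weak solution of $\mathscr{H}_\alpha u=h$ in $\mathbb{R}^n$, for some constant $h\in\mathbb{R}$. Then $h=0$.
   Context: Let $G(t):=\int_0^t \frac{d\tau}{(1+\tau^2)^{\frac{n+1+\alpha}{2}}}$ for $t\in\mathbb{R}$ (a bounded function). Let $W^{\alpha,1}(\mathbb{R}^n)$ be the fractional Sobolev space of functions $v\in L^1(\mathbb{R}^n)$ with $\int_{\mathbb{R}^n}\int_{\mathbb{R}^n}\frac{|v(x')-v(y')|}{|x'-y'|^{n+\alpha}}\,dx'\,dy'<+\infty$. For a measurable function $u:\mathbb{R}^n\to\mathbb{R}$, define the linear form $\mathscr{H}_\alpha u$ on $W^{\alpha,1}(\mathbb{R}^n)$ by $$\langle\mathscr{H}_\alpha u,v\rangle:=\int_{\mathbb{R}^n}\int_{\mathbb{R}^n}G\left(\frac{u(x')-u(y')}{|x'-y'|}\right)\big(v(x')-v(y')\big)\frac{dx'\,dy'}{|x'-y'|^{n+\alpha}}.$$ A measurable function $u:\mathbb{R}^n\to\mathbb{R}$ is a weak solution of $\mathscr{H}_\alpha u=h$ in $\mathbb{R}^n$ if $$\langle\mathscr{H}_\alpha u,v\rangle=h\int_{\mathbb{R}^n}v(x')\,dx'\quad\text{for every } v\in W^{\alpha,1}(\mathbb{R}^n).$$ *)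

(* Defs.v *)
From HB Require Import structures.
From mathcomp Require Import all_boot all_order all_algebra.
From mathcomp Require Import all_classical all_reals all_analysis.

Set Implicit Arguments.
Unset Strict Implicit.
Unset Printing Implicit Defensive.
Import Order.TTheory GRing.Theory Num.Theory.
Import numFieldNormedType.Exports.

Local Open Scope classical_set_scope.
Local Open Scope ring_scope.

(* Product of a measure on T and a measure on T^n, carried to T^(n+1). *)
Section cons_product.
Local Open Scope ereal_scope.
Context d (T : measurableType d) (R : realType) (n : nat).
Variables (mu1 : {sigma_finite_measure set T -> \bar R})
          (mu2 : {sigma_finite_measure set (n.-tuple T) -> \bar R}).

Let consp (p : T * n.-tuple T) : n.+1.-tuple T := cons_tuple p.1 p.2.

Definition cons_product : set (n.+1.-tuple T) -> \bar R :=
  pushforward (mu1 \x mu2) consp.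

Let measurable_consp : measurable_fun setT consp.
Proof. exact: measurable_cons. Qed.

Let mu_ : {measure set (n.+1.-tuple T) -> \bar R} :=
  measure_function_pushforward__canonical__measure_function_Measure
    (mu1 \x mu2) measurable_consp.

HB.instance Definition _ := isMeasure.Build _ _ _ cons_product
  (measure0 mu_) (measure_ge0 mu_) (@measure_semi_sigma_additive _ _ _ mu_).

Lemma cons_product_sigma_finite : sigma_finite setT cons_product.
Proof.
pose g := fun t : n.+1.-tuple T => (thead t, [tuple of behead t]).
have mg : measurable_fun setT g.
  by apply: measurable_fun_pair; [exact: measurable_tnth|exact: measurable_behead].
have gK : cancel consp g.
  by case=> x t; congr pair; exact: val_inj.
have /sigma_finiteP[F [FT ndF Foo]] := sigma_finiteT mu1.
have /sigma_finiteP[H [HT ndH Hoo]] := sigma_finiteT mu2.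
exists (fun i => g @^-1` (F i `*` H i)) => [|i].
  rewrite -preimage_bigcup (_ : \bigcup_i _ = setT) ?preimage_setT//.
  apply/seteqP; split => // -[x y] _.
  have [i _ Fix] : (\bigcup_i F i) x by rewrite -FT.
  have [j _ Hjy] : (\bigcup_i H i) y by rewrite -HT.
  exists (maxn i j) => //; split.
    by apply: subsetPset (ndF _ _ (leq_maxl i j)) _ Fix.
  by apply: subsetPset (ndH _ _ (leq_maxr i j)) _ Hjy.
have [mF Fioo] := Foo i; have [mH Hioo] := Hoo i; split.
  by rewrite -[X in measurable X]setTI; apply: mg => //; exact: measurableX.
rewrite /cons_product /pushforward -comp_preimage.
rewrite (_ : g \o consp = id); last by apply/funext => p /=; rewrite gK.
by rewrite preimage_id product_measure1E// lte_mul_pinfty// ge0_fin_numE.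
Qed.

HB.instance Definition _ := Measure_isSigmaFinite.Build _ _ _ cons_product
  cons_product_sigma_finite.

End cons_product.

Section lebesgue_Rn.
Context (R : realType).

(* Lebesgue measure on the Borel sets of R^n, as an iterated product; the
   degenerate case n = 0 is the unit mass on the one point space. *)
Fixpoint borel_lebesgue (n : nat) :
    {sigma_finite_measure set (n.-tuple (measurableTypeR R)) -> \bar R} :=
  match n with
  | 0%N => dirac [tuple]
  | m.+1 => cons_product lebesgue_measure (borel_lebesgue m)
  end.

(* R^n equipped with its Lebesgue (and not merely Borel) sigma-algebra. *)
Definition euclidean (n : nat) :=
  caratheodory_type ((borel_lebesgue n)^*)%mu.

HB.instance Definition _ n := Measurable.on (euclidean n).

Definition lebesgue (n : nat) : set (euclidean n) -> \bar R :=
  @completed_measure_extension _ _ _ (borel_lebesgue n).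
Arguments lebesgue : clear implicits.

HB.instance Definition _ n := Measure.on (lebesgue n).

Lemma lebesgue_sigma_finite n : sigma_finite setT (lebesgue n).
Proof. exact/completed_measure_extension_sigma_finite/sigma_finiteT. Qed.

HB.instance Definition _ n := Measure_isSigmaFinite.Build _ _ _ (lebesgue n)
  (@lebesgue_sigma_finite n).

Definition eucl_dist (n : nat) (x y : euclidean n) : R :=
  Num.sqrt (\sum_(i < n) (tnth x i - tnth y i) ^+ 2).

(* Integral from 0 to t with the usual sign convention for t < 0. *)
Definition kernelG (n : nat) (alpha t : R) : R :=
  let g tau := ((1 + tau ^+ 2) `^ ((n%:R + 1 + alpha) / 2))^-1 in
  if 0 <= t then \int[lebesgue_measure]_(tau in `[0, t]) g tau
  else - \int[lebesgue_measure]_(tau in `[t, 0]) g tau.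

(* On the diagonal, a null set, the quotients below are 0 since x / 0 = 0. *)
Definition fracSobolev (n : nat) (alpha : R) (v : euclidean n -> R) : Prop :=
  (lebesgue n).-integrable setT (EFin \o v) /\
  (\int[lebesgue n \x lebesgue n]_z
     (`|v z.1 - v z.2| / eucl_dist z.1 z.2 `^ (n%:R + alpha))%:E < +oo)%E.

Definition Hpairing (n : nat) (alpha : R) (u v : euclidean n -> R) : R :=
  \int[(lebesgue n \x lebesgue n)%E]_z
    (kernelG n alpha ((u z.1 - u z.2) / eucl_dist z.1 z.2) * (v z.1 - v z.2) /
     eucl_dist z.1 z.2 `^ (n%:R + alpha)).

Definition weak_solution (n : nat) (alpha : R) (u : euclidean n -> R) (h : R)
    : Prop :=
  measurable_fun setT u /\
  forall v : euclidean n -> R, fracSobolev alpha v ->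
    Hpairing alpha u v = h * \int[lebesgue n]_x v x.

End lebesgue_Rn.

Arguments borel_lebesgue : clear implicits.
Arguments lebesgue : clear implicits.

(* Main.v *)
Require Import Defs.
From HB Require Import structures.
From mathcomp Require Import all_boot all_order all_algebra.
From mathcomp Require Import all_classical all_reals all_analysis.
From mathcomp Require Import measurable_realfun.
From mathcomp Require Import ring lra.
Import Order.TTheory GRing.Theory Num.Theory.
Local Open Scope ring_scope.

Set Implicit Arguments.
Unset Strict Implicit.
Unset Printing Implicit Defensive.
Import numFieldNormedType.Exports.
Local Open Scope classical_set_scope.

(** The idea is to test the equation with functions spread over larger and
    larger regions. As G is bounded, the pairing of H_alpha u with v is at most
    a constant times the Gagliardo seminorm
    [[
      [v] = int int |v(x) - v(y)| / |x - y|^(n + alpha) dx dy,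
    ]]
    and this bound does not see u at all. A weak solution therefore satisfies
    |h| |int v| <= C [v] for every v. Under a dilation by the factor L the
    integral of v scales like L^n and the seminorm like L^(n - alpha), so that
    |h| <= C' L^(- alpha) for all L > 0, and h = 0.

    The family of test functions is the l1 tent v_L(x) = max(0, 1 - |x|_1 / L).
    It is explicit enough to make the scaling visible by direct estimates, with
    no change of variables:
    - its integral is at least (L / n)^n / 2, since v_L >= 1/2 on a cube of side
      L / n ([integral_tent_ge]);
    - it is supported in the cube of side 2 L and satisfies
      |v_L(x) - v_L(y)| <= n min(1, |x - y| / L) ([tent_lipschitz]), so only
      pairs with one point in that cube count, and the kernel becomes
      min(1, |x - y| / L) / |x - y|^(n + alpha). Cutting the values of |x - y|
      at the points L 2^j, j an integer, dominates this kernel by a weighted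
      sum of indicators of sets of pairs whose coordinates differ by at most
      2 s, with s = L 2^j ([dyadic_radial_bound]). Each such set has measure of order
      L^n s^n ([close_pairs_measure_le]). Summing gives L^n times two geometric
      series, one for |x - y| >= L, convergent because alpha > 0, and one for
      |x - y| < L, convergent because alpha < 1; both are of order L^(- alpha)
      ([tent_seminorm]). *)

(** * Comparison of integrals *)

Section domination.
Local Open Scope ereal_scope.
Context d (T : measurableType d) (R : realType).
Variable mu : {measure set T -> \bar R}.
Implicit Types (D : set T) (f g : T -> \bar R).

(** The integral of a nonnegative function is the supremum of the integrals of
    the simple functions below it; a larger function only enlarges the set over
    which this supremum is taken, measurable or not. *)
Lemma le_integral_dominated D f g : (forall x, D x -> 0 <= f x <= g x) ->
  \int[mu]_(x in D) f x <= \int[mu]_(x in D) g x.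
Proof.
move=> fg; have f0 x : D x -> 0 <= f x by move=> /fg/andP[].
have g0 x : D x -> 0 <= g x by move=> /fg/andP[]; exact: le_trans.
rewrite !ge0_integralE//; apply: le_ereal_sup => _ [h hf <-]; exists h => // x.
apply: (le_trans (hf x)); rewrite /patch; case: ifPn => // /[1!inE] Dx.
by have /andP[] := fg _ Dx.
Qed.

(** The integral is a difference P - N of two numbers between 0 and the integral
    of the dominating function g, hence is at most that integral in modulus. *)
Lemma abse_integral_le D f g : (forall x, D x -> `|f x| <= g x) ->
  `|\int[mu]_(x in D) f x| <= \int[mu]_(x in D) g x.
Proof.
move=> fg; rewrite integralE.
have := @le_integral_dominated D (f^\+) g; have := @le_integral_dominated D (f^\-) g.
set P := \int[mu]_(x in D) f^\+ x; set N := \int[mu]_(x in D) f^\- x.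
set G := \int[mu]_(x in D) g x.
have P0 : 0 <= P by apply: integral_ge0 => x _; exact: funepos_ge0.
have N0 : 0 <= N by apply: integral_ge0 => x _; exact: funeneg_ge0.
move=> NG PG.
have {}PG : P <= G.
  apply: PG => x /fg fgx; rewrite funepos_ge0/=; apply: le_trans fgx.
  by rewrite funeposE ge_max lee_abs abse_ge0.
have {}NG : N <= G.
  apply: NG => x /fg fgx; rewrite funeneg_ge0/=; apply: le_trans fgx.
  by rewrite funenegE ge_max abse_ge0 -abseN lee_abs.
case: (ltP G +oo) => [Goo|]; last by rewrite leye_eq => /eqP ->; rewrite leey.
have Pf : P \is a fin_num by rewrite ge0_fin_numE//; exact: le_lt_trans Goo.
have Nf : N \is a fin_num by rewrite ge0_fin_numE//; exact: le_lt_trans Goo.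
have Gf : G \is a fin_num by rewrite ge0_fin_numE//; exact: le_trans PG.
move: P N G Pf Nf Gf P0 N0 PG NG {Goo} => [p| |] [q| |] [r| |]//= _ _ _.
rewrite !lee_fin => p0 q0 pr qr; rewrite ler_norml; apply/andP; split; lra.
Qed.

End domination.

(** * Lebesgue measure of cubes *)

Section lebesgue_cubes.
Context (R : realType).

Definition cube n (x : n.-tuple R) (r : R) : set (n.-tuple R) :=
  [set y | forall i, `|tnth x i - tnth y i| <= r].

Lemma measurable_cube n (x : n.-tuple R) r :
  measurable (cube x r : set (n.-tuple (measurableTypeR R))).
Proof.
rewrite (_ : cube x r = \big[setI/setT]_(i < n)
    ((fun y : n.-tuple (measurableTypeR R) => tnth y i) @^-1`
       `[tnth x i - r, tnth x i + r])); last first.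
  apply/seteqP; split => y /=.
    move=> xy; elim/big_rec: _ => // i A _ Ay; split => //=.
    by have := xy i; rewrite in_itv/= ler_norml; lra.
  move=> xy i; rewrite (bigD1 i)//= in xy; case: xy => /= + _.
  by rewrite in_itv/= ler_norml; lra.
apply: bigsetI_measurable => i _; rewrite -[X in measurable X]setTI.
exact: measurable_tnth.
Qed.

(** A cube in dimension n + 1 is the product of an interval and of a cube in
    dimension n, and the measure is an iterated product by construction. *)
Lemma borel_lebesgue_cube n (x : n.-tuple R) r : 0 <= r ->
  borel_lebesgue R n (cube x r) = ((2 * r) ^+ n)%:E.
Proof.
move=> r0; elim: n x => [x|n IH x].
  rewrite /= diracE expr0 mem_set// => -[]//.
rewrite /= /cons_product /pushforward.
rewrite (_ : _ @^-1` _ = `[thead x - r, thead x + r] `*` cube [tuple of behead x] r).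
  rewrite product_measure1E ?IH//; last exact: measurable_cube.
  have itvE : lebesgue_measure (`[thead x - r, thead x + r] : set R) = (2 * r)%:E.
    rewrite lebesgue_measure_itv/= lte_fin.
    by case: ltP => h; rewrite -?EFinB; congr _%:E; lra.
  by rewrite exprS EFinM; congr (_ * _)%E; exact: itvE.
apply/seteqP; split => -[a t]/=.
  move=> h; split.
    by have := h ord0; rewrite /= in_itv/= ler_norml tnth0 /thead; lra.
  move=> i; have := h (lift ord0 i); rewrite !(tnth_nth 0)/=.
  by rewrite nth_behead.
rewrite /= in_itv/= => -[h1 h2] i; case: (unliftP ord0 i) => [j ->|->].
  by have := h2 j; rewrite !(tnth_nth 0)/= nth_behead.
by rewrite tnth0 ler_norml; move: h1; rewrite /thead; lra.
Qed.

(** Cubes are Borel sets, on which the completed measure is the Borel one. *)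
Lemma lebesgue_cube n (x : euclidean R n) r : 0 <= r ->
  lebesgue R n (cube x r) = ((2 * r) ^+ n)%:E.
Proof.
move=> r0; rewrite -(borel_lebesgue_cube x r0).
by apply: measurable_mu_extE; exact: measurable_cube.
Qed.

(** Borel sets are Lebesgue measurable. *)
Lemma measurable_coord n (i : 'I_n) :
  measurable_fun setT (fun x : euclidean R n => tnth x i).
Proof.
move=> _ Y mY; apply: sub_caratheodory; apply: sub_sigma_algebra.
exact: (@measurable_tnth _ (measurableTypeR R) n i).
Qed.

End lebesgue_cubes.

(** * Pairs of close points, one of them in a cube *)

Section close_pairs_measure.
Context (R : realType) (n : nat).
Local Notation E := (euclidean R n).
Local Notation mu := (lebesgue R n).
Local Notation origin := (nseq_tuple n (0 : R)).

Lemma measurable_euclidean_cube (x : E) (r : R) :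
  measurable (cube x r : set E).
Proof.
by apply: sub_caratheodory; apply: sub_sigma_algebra; exact: measurable_cube.
Qed.

(** A function supported in the cube of half-side L about the origin has equal
    values at x and y unless one of the points, and not necessarily both, lies
    in that cube; hence the disjunction. *)
Definition close_pairs (L r : R) : set (E * E) :=
  [set z | (cube origin L z.1 \/ cube origin L z.2) /\ cube z.1 r z.2].

Lemma measurable_close (r : R) : measurable [set z : E * E | cube z.1 r z.2].
Proof.
rewrite (_ : [set _ | _] = \big[setI/setT]_(i < n)
    ((fun z : E * E => tnth z.1 i - tnth z.2 i) @^-1` `[- r, r])); last first.
  apply/seteqP; split => z /=.
    move=> xy; elim/big_rec: _ => // i A _ Ay; split => //=.
    by have := xy i; rewrite in_itv/= ler_norml; lra.
  move=> xy i; rewrite (bigD1 i)//= in xy; case: xy => /= + _.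
  by rewrite in_itv/= ler_norml; lra.
apply: bigsetI_measurable => i _; rewrite -[X in measurable X]setTI.
apply: measurable_funB => //.
  exact: (measurableT_comp (@measurable_coord R n i) measurable_fst).
exact: (measurableT_comp (@measurable_coord R n i) measurable_snd).
Qed.

Lemma measurable_close_pairs_fst (L r : R) :
  measurable [set z : E * E | cube origin L z.1 /\ cube z.1 r z.2].
Proof.
apply: measurableI (measurable_close r).
rewrite -[X in measurable X]setTI.
by apply: measurable_fst => //; exact: measurable_euclidean_cube.
Qed.

Lemma measurable_close_pairs_snd (L r : R) :
  measurable [set z : E * E | cube origin L z.2 /\ cube z.1 r z.2].
Proof.
apply: measurableI (measurable_close r).
rewrite -[X in measurable X]setTI.
by apply: measurable_snd => //; exact: measurable_euclidean_cube.
Qed.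

Lemma close_pairsE (L r : R) : close_pairs L r =
  [set z : E * E | cube origin L z.1 /\ cube z.1 r z.2] `|`
  [set z : E * E | cube origin L z.2 /\ cube z.1 r z.2].
Proof. by apply/seteqP; split => z; rewrite /close_pairs/=; tauto. Qed.

Lemma measurable_close_pairs (L r : R) : measurable (close_pairs L r).
Proof.
rewrite close_pairsE; apply: measurableU.
  exact: measurable_close_pairs_fst.
exact: measurable_close_pairs_snd.
Qed.

Lemma cubeC (x y : n.-tuple R) (r : R) : cube x r y <-> cube y r x.
Proof. by split => h i; rewrite distrC. Qed.

Lemma measurable_indic_cube (x : E) (r : R) :
  measurable_fun setT (fun y : E => (\1_(cube x r : set E) y : R)%:E).
Proof.
by apply/measurable_EFinP/measurable_indic; exact: measurable_euclidean_cube.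
Qed.

Lemma integral_cube_section (L r : R) : 0 <= L -> 0 <= r ->
  (\int[mu]_x \int[mu]_y (\1_(cube origin L) x * \1_(cube x r) y)%:E =
   ((2 * L) ^+ n * (2 * r) ^+ n)%:E)%E.
Proof.
move=> L0 r0.
have inner x : (\int[mu]_y (\1_(cube origin L) x * \1_(cube x r) y)%:E =
    ((2 * r) ^+ n)%:E * (\1_(cube origin L : set E) x)%:E)%E.
  under eq_integral do rewrite EFinM.
  rewrite ge0_integralZl_EFin; [|by []|by []|exact: measurable_indic_cube|by []].
  rewrite integral_indic; [|by []|exact: measurable_euclidean_cube].
  by rewrite setIT muleC; congr (_ * _)%E; exact: lebesgue_cube.
under eq_integral do rewrite inner.
rewrite ge0_integralZl_EFin; [|by []|by []|exact: measurable_indic_cube|].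
  rewrite integral_indic; [|by []|exact: measurable_euclidean_cube].
  rewrite setIT [RHS]EFinM muleC; congr (_ * _)%E; exact: lebesgue_cube.
by rewrite exprn_ge0 ?mulr_ge0.
Qed.

Lemma indic_cube_conj (x y : E) (L r : R) (P : Prop) :
  (P <-> cube origin L x /\ cube x r y) ->
  (\1_(cube origin L : set E) x * \1_(cube x r : set E) y)%:E = ((asbool P)%:R : R)%:E.
Proof.
move=> PE; rewrite !indicE -natrM mulnb; congr ((nat_of_bool _)%:R%:E).
apply/idP/asboolP => [/andP[]|/PE[? ?]]; first by rewrite !inE PE.
by apply/andP; rewrite !inE.
Qed.

Lemma close_pairs_fst_measure (L r : R) : 0 <= L -> 0 <= r ->
  (mu \x mu)%E [set z : E * E | cube origin L z.1 /\ cube z.1 r z.2] =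
  ((2 * L) ^+ n * (2 * r) ^+ n)%:E.
Proof.
move=> L0 r0; rewrite -integral_cube_section//.
have mA := measurable_close_pairs_fst L r; set A := [set z | _] in mA *.
transitivity (\int[mu \x mu]_z (\1_A z)%:E)%E.
  by rewrite integral_indic; [rewrite setIT|by []|by []].
rewrite fubini_tonelli1; [|exact/measurable_EFinP/measurable_indic|by []].
apply: eq_integral => x _; apply: eq_integral => y _ /=.
by rewrite (@indic_cube_conj _ _ _ _ (A (x, y))) ?indicE//.
Qed.

(** Tonelli with the second variable outermost reduces this to the same iterated
    integral as for the first variable. *)
Lemma close_pairs_snd_measure (L r : R) : 0 <= L -> 0 <= r ->
  (mu \x mu)%E [set z : E * E | cube origin L z.2 /\ cube z.1 r z.2] =
  ((2 * L) ^+ n * (2 * r) ^+ n)%:E.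
Proof.
move=> L0 r0; rewrite -integral_cube_section//.
have mA := measurable_close_pairs_snd L r; set A := [set z | _] in mA *.
transitivity (\int[mu \x mu]_z (\1_A z)%:E)%E.
  by rewrite integral_indic; [rewrite setIT|by []|by []].
rewrite fubini_tonelli2; [|exact/measurable_EFinP/measurable_indic|by []].
apply: eq_integral => x _; apply: eq_integral => y _ /=.
rewrite (@indic_cube_conj _ _ _ _ (A (y, x))) ?indicE//.
by split => -[Qx xy]; split => //; exact/cubeC.
Qed.

Lemma close_pairs_measure_le (L r : R) : 0 <= L -> 0 <= r ->
  ((mu \x mu)%E (close_pairs L r) <= (2 * ((2 * L) ^+ n * (2 * r) ^+ n))%:E)%E.
Proof.
move=> L0 r0; rewrite close_pairsE; apply: le_trans (measureU2 _ _ _) _.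
- exact: measurable_close_pairs_fst.
- exact: measurable_close_pairs_snd.
rewrite mulr_natl mulr2n EFinD; apply: leeD; rewrite le_eqVlt; apply/orP; left.
  by apply/eqP; exact: close_pairs_fst_measure.
by apply/eqP; exact: close_pairs_snd_measure.
Qed.

End close_pairs_measure.

(** * The function G is bounded *)

Section bounded_kernel.
Context (R : realType).

Lemma integral_oneDsqrV_le (a b : R) : a <= b ->
  (\int[lebesgue_measure]_(x in `[a, b]) ((oneDsqr x)^-1)%:E <= pi%:E)%E.
Proof.
rewrite le_eqVlt => /predU1P[<-|ab].
  by rewrite set_itv1 integral_set1 lee_fin pi_ge0.
rewrite (@continuous_FTC2 _ _ atan)//.
- by rewrite -EFinB lee_fin; have := atan_ltpi2 b; have := atan_gtNpi2 a; lra.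
- by apply: continuous_in_subspaceT => x ?; exact: continuous_oneDsqrV.
- split.
  + by move=> x _; exact: derivable_atan.
  + by apply: cvg_at_right_filter; exact: continuous_atan.
  + by apply: cvg_at_left_filter; exact: continuous_atan.
- by move=> x x01; rewrite derive1_atan// mul1r.
Qed.

(** The exponent (n + 1 + alpha) / 2 is at least 1, so the integrand of G lies
    below 1 / (1 + tau^2), the derivative of atan. *)
Lemma kernelG_bounded n (alpha t : R) : (1 <= n)%N -> 0 < alpha ->
  `|kernelG n alpha t| <= pi.
Proof.
move=> n1 alpha0.
have n1R : (1 : R) <= n%:R by rewrite ler1n.
pose g (tau : R) := ((1 + tau ^+ 2) `^ ((n%:R + 1 + alpha) / 2))^-1.
have g_ge0 tau : 0 <= g tau by rewrite invr_ge0 powR_ge0.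
have g_le tau : g tau <= (oneDsqr tau)^-1.
  have base_gt0 : 0 < 1 + tau ^+ 2 by rewrite ltr_wpDr ?sqr_ge0.
  rewrite lef_pV2 ?posrE ?powR_gt0//.
  by apply: le1r_powR; [exact: oneDsqr_ge1|lra].
have bound a b : a <= b -> `|\int[lebesgue_measure]_(tau in `[a, b]) g tau| <= pi.
  move=> ab; set I := (\int[lebesgue_measure]_(tau in `[a, b]) (g tau)%:E)%E.
  have I_le : (I <= pi%:E)%E.
    apply: le_trans (integral_oneDsqrV_le ab); apply: le_integral_dominated => x _.
    by rewrite !lee_fin g_ge0 g_le.
  have I_ge0 : (0 <= I)%E by apply: integral_ge0 => x _; rewrite lee_fin.
  rewrite /Rintegral ger0_norm ?fine_ge0// -lee_fin fineK//.
  by rewrite ge0_fin_numE// (le_lt_trans I_le) ?ltry.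
rewrite /kernelG; case: ifPn => t0; first exact: bound.
by rewrite normrN; apply: bound; rewrite ltW// ltNge.
Qed.

End bounded_kernel.

(** * Dyadic decomposition of the kernel *)

Section dyadic.
Context (R : realType).

Lemma dyadic_scale (t : R) : 1 <= t -> exists j, 2 ^+ j <= t <= 2 ^+ j.+1.
Proof.
move=> t1; have t0 : 0 <= t by lra.
have /andP[lot hit] := Num.Theory.truncn_itv t0.
set m := Num.trunc t in lot hit.
have m0 : (0 < m)%N.
  by rewrite -(ltr_nat R); rewrite -natr1 in hit; lra.
have /andP[lom him] := trunc_log_bounds (isT : (1 < 2)%N) m0.
exists (trunc_log 2 m); apply/andP; split.
  by apply: le_trans lot; rewrite -natrX ler_nat.
by apply: (le_trans (ltW hit)); rewrite -natrX ler_nat.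
Qed.

(** For d >= L, the factor min(1, d / L) is 1 and d lies between s and 2 s for
    some s = L 2^j. For d < L, it lies between s and 2 s for some
    s = L 2^-(j + 1), and then min(1, d / L) = d / L <= 2^-j. In both cases
    d^-p <= s^-p. *)
Lemma dyadic_radial_bound (p L d : R) : 0 <= p -> 0 < L -> 0 < d ->
  exists j,
    (d <= 2 * (L * 2 ^+ j) /\
      Num.min 1 (d / L) / d `^ p <= ((L * 2 ^+ j) `^ p)^-1) \/
    (d <= 2 * (L * 2^-1 ^+ j.+1) /\
      Num.min 1 (d / L) / d `^ p <= 2^-1 ^+ j * ((L * 2^-1 ^+ j.+1) `^ p)^-1).
Proof.
move=> p0 L0 d0.
have inv_le s : 0 < s -> s <= d -> (d `^ p)^-1 <= (s `^ p)^-1.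
  move=> s0 sd; rewrite lef_pV2 ?posrE ?powR_gt0//.
  by apply: ge0_ler_powR; rewrite ?nnegrE// ltW.
have V0 s : 0 <= (s `^ p)^-1 by rewrite invr_ge0 powR_ge0.
have m0 : 0 <= Num.min 1 (d / L) by rewrite le_min ler01 divr_ge0 ?ltW.
have [Ld|dL] := leP L d.
  have [|j /andP[lo hi]] := @dyadic_scale (d / L).
    by rewrite ler_pdivlMr// mul1r.
  exists j; left; split.
    by move: hi; rewrite ler_pdivrMr// exprS; lra.
  rewrite -[leRHS]mul1r ler_pM//; first by rewrite ge_min lexx.
  apply: inv_le; first by rewrite mulr_gt0// exprn_gt0.
  by move: lo; rewrite ler_pdivlMr// mulrC.
have [|j /andP[lo hi]] := @dyadic_scale (L / d).
  by rewrite ler_pdivlMr// mul1r ltW.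
have e0 k : 0 < 2 ^+ k :> R by rewrite exprn_gt0.
have dLj : d <= L * 2^-1 ^+ j.
  by rewrite exprVn ler_pdivlMr//; move: lo; rewrite ler_pdivlMr// mulrC.
exists j; right; split.
  by move: dLj; rewrite exprS; lra.
rewrite ler_pM//.
  by rewrite ge_min; apply/orP; right; rewrite ler_pdivrMr// mulrC.
apply: inv_le; first by rewrite mulr_gt0// exprn_gt0// invr_gt0.
by rewrite exprVn ler_pdivrMr//; move: hi; rewrite ler_pdivrMr// mulrC.
Qed.

(** The weight s^-(n + alpha) of a shell times the volume of a cube of half-side
    2 s: only the power s^-alpha remains, so the weights of the shells form a
    geometric progression when s runs through the dyadic scales. *)
Lemma shell_mass n (alpha s : R) : 0 < s ->
  (s `^ (n%:R + alpha))^-1 * (2 * (2 * s)) ^+ n = 4 ^+ n * s `^ (- alpha).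
Proof.
move=> s0; rewrite powRD; last by rewrite (gt_eqF s0)/= implybT.
rewrite powR_mulrn ?ltW// powRN mulrA exprMn (_ : 2 * 2 = 4)//; last by lra.
have sn0 : s ^+ n != 0 by rewrite expf_neq0 ?gt_eqF.
have sa0 : s `^ alpha != 0 by rewrite gt_eqF ?powR_gt0.
by field; rewrite sa0 sn0.
Qed.

Lemma powR_exprn (a x : R) j : 0 <= a -> (a ^+ j) `^ x = (a `^ x) ^+ j.
Proof.
by move=> a0; rewrite -(powR_mulrn j a0) -(powR_mulrn j (powR_ge0 a x)) powRAC.
Qed.

Lemma geometric_eseries_le (u : nat -> \bar R) (a q : R) :
  0 <= a -> 0 <= q -> q < 1 ->
  (forall j, 0 <= u j <= (a * q ^+ j)%:E)%E ->
  (\sum_(0 <= j <oo) u j <= (a / (1 - q))%:E)%E.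
Proof.
move=> a0 q0 q1 hu.
have u0 j : (0 <= u j)%E by have /andP[] := hu j.
apply: lime_le; first exact: is_cvg_nneseries.
near=> N; apply: (@le_trans _ _ (\sum_(0 <= j < N) (a * q ^+ j)%:E)%E).
  by apply: lee_sum => j _; have /andP[] := hu j.
rewrite sumEFin lee_fin -mulr_sumr ler_wpM2l//.
rewrite -(ler_pM2r (_ : 0 < 1 - q)) ?subr_gt0// mulVf ?gt_eqF ?subr_gt0//.
have : 0 <= q ^+ N by rewrite exprn_ge0.
rewrite big_mkord mulrC; have := subrX1 q N; lra.
Unshelve. all: by end_near. Qed.

End dyadic.

(** * Tent functions *)

Section tent.
Context (R : realType) (n : nat).
Local Notation E := (euclidean R n).
Local Notation mu := (lebesgue R n).
Local Notation origin := (nseq_tuple n (0 : R)).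

Lemma sum_const_ord (c : R) : \sum_(i < n) c = n%:R * c.
Proof. by rewrite sumr_const card_ord mulr_natl. Qed.

(** The l1 norm makes the tent Lipschitz in terms of the coordinates alone, which
    avoids the triangle inequality for the Euclidean distance. *)
Definition l1norm (x : E) : R := \sum_(i < n) `|tnth x i|.

Definition tent (L : R) (x : E) : R := Num.max 0 (1 - l1norm x / L).

Lemma l1norm_ge0 x : 0 <= l1norm x.
Proof. by apply: sumr_ge0. Qed.

Lemma coord_le_l1norm (x : E) i : `|tnth x i| <= l1norm x.
Proof. by rewrite /l1norm (bigD1 i)//= lerDl sumr_ge0. Qed.

Lemma coord_le_eucl_dist (x y : E) i : `|tnth x i - tnth y i| <= eucl_dist x y.
Proof.
rewrite -sqrtr_sqr ler_wsqrtr// (bigD1 i)//= lerDl.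
by apply: sumr_ge0 => j _; exact: sqr_ge0.
Qed.

Lemma eucl_dist_ge0 (x y : E) : 0 <= eucl_dist x y.
Proof. exact: sqrtr_ge0. Qed.

Lemma eucl_dist_cube (x y : E) r : eucl_dist x y <= r -> cube x r y.
Proof. by move=> xy i; exact: le_trans (coord_le_eucl_dist x y i) xy. Qed.

Lemma l1norm_lipschitz (x y : E) :
  `|l1norm x - l1norm y| <= n%:R * eucl_dist x y.
Proof.
rewrite /l1norm -sumrB (le_trans (ler_norm_sum _ _ _))//.
rewrite -sum_const_ord.
apply: ler_sum => i _; apply: le_trans (coord_le_eucl_dist x y i).
exact: ler_dist_dist.
Qed.

Lemma measurable_tent (L : R) : measurable_fun setT (tent L).
Proof.
apply: measurable_maxr; first exact: measurable_cst.
apply: measurable_funB; first exact: measurable_cst.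
apply: measurable_funM; last exact: measurable_cst.
apply: measurable_sum => i.
exact: (measurableT_comp (@normr_measurable R setT) (@measurable_coord R n i)).
Qed.

Variables (L : R) (L0 : 0 < L).

Lemma tent_ge0 x : 0 <= tent L x.
Proof. by rewrite le_max lexx. Qed.

Lemma tent_le1 x : tent L x <= 1.
Proof.
by rewrite ge_max ler01/= gerBl divr_ge0 ?l1norm_ge0 ?ltW.
Qed.

Lemma tent_supp x : ~ cube origin L x -> tent L x = 0.
Proof.
move=> xL; apply/max_idPl; rewrite subr_le0 leNgt; apply/negP => Sx.
apply: xL => i; rewrite tnth_nseq sub0r normrN.
apply: (le_trans (coord_le_l1norm x i)).
by move: Sx; rewrite ltr_pdivrMr// mul1r => /ltW.
Qed.

Lemma tent_le_indic x : tent L x <= \1_(cube origin L : set E) x.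
Proof.
rewrite indicE; have [xL|xL] := pselect (cube origin L x).
  by rewrite mem_set// tent_le1.
by rewrite memNset// tent_supp.
Qed.

Lemma tent_lipschitz x y : (1 <= n)%N ->
  `|tent L x - tent L y| <= n%:R * Num.min 1 (eucl_dist x y / L).
Proof.
move=> n1; rewrite minr_pMr// le_min mulr1; apply/andP; split.
  have := tent_ge0 x; have := tent_ge0 y; have := tent_le1 x; have := tent_le1 y.
  have : (1 : R) <= n%:R by rewrite ler1n.
  by rewrite ler_norml => ? ? ? ? ?; apply/andP; split; lra.
have maxD (a b : R) : `|Num.max 0 a - Num.max 0 b| <= `|a - b|.
  have := ler_norm (a - b); have := ler_norm (b - a); rewrite (distrC b a).
  case: (leP 0 a) => ?; case: (leP 0 b) => ? ? ?;
    rewrite ler_norml; apply/andP; split; lra.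
apply: (le_trans (maxD _ _)).
have -> : 1 - l1norm x / L - (1 - l1norm y / L) = (l1norm y - l1norm x) * L^-1.
  by rewrite mulrBl; lra.
rewrite normrM (gtr0_norm (_ : 0 < L^-1)) ?invr_gt0//.
rewrite mulrA ler_wpM2r ?invr_ge0 ?(ltW L0)// distrC.
exact: l1norm_lipschitz.
Qed.

Lemma integral_tent_le : (\int[mu]_x (tent L x)%:E <= ((2 * L) ^+ n)%:E)%E.
Proof.
apply: (@le_trans _ _ (\int[mu]_x (\1_(cube origin L : set E) x)%:E)%E).
  apply: le_integral_dominated => x _.
  by rewrite !lee_fin tent_ge0 tent_le_indic.
rewrite integral_indic; [|by []|exact: measurable_euclidean_cube].
rewrite setIT le_eqVlt; apply/orP; left; apply/eqP.
by apply: lebesgue_cube; exact: ltW.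
Qed.

(** On the cube of half-side L / (2 n) the l1 norm is at most L / 2, so the tent
    is at least 1/2 there. *)
Lemma integral_tent_ge : (1 <= n)%N ->
  ((2^-1 * (L / n%:R) ^+ n)%:E <= \int[mu]_x (tent L x)%:E)%E.
Proof.
move=> n1; have n0 : 0 < n%:R :> R by rewrite ltr0n.
set r := L / (2 * n%:R).
have r0 : 0 <= r by rewrite divr_ge0 ?mulr_ge0 ?ltW.
have -> : L / n%:R = 2 * r by rewrite /r; field; lra.
apply: (@le_trans _ _ (\int[mu]_x (2^-1%:E * (\1_(cube origin r : set E) x)%:E))%E).
  rewrite ge0_integralZl_EFin; [|by []|by []|exact: measurable_indic_cube|by []].
  rewrite integral_indic; [|by []|exact: measurable_euclidean_cube].
  rewrite setIT EFinM lee_wpmul2l ?lee_fin// le_eqVlt; apply/orP; left; apply/eqP.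
  by apply/esym; exact: lebesgue_cube.
apply: le_integral_dominated => x _; rewrite -EFinM !lee_fin mulr_ge0//=.
rewrite indicE; have [xr|xr] := pselect (cube origin r x); last first.
  by rewrite memNset// mulr0 tent_ge0.
rewrite mem_set// mulr1 le_max; apply/orP; right.
suff : l1norm x / L <= 2^-1 by lra.
rewrite ler_pdivrMr//.
have -> : 2^-1 * L = n%:R * r by rewrite /r; field; lra.
rewrite -sum_const_ord; apply: ler_sum => i _.
by have := xr i; rewrite tnth_nseq sub0r normrN.
Qed.

Lemma integrable_tent : mu.-integrable setT (EFin \o tent L).
Proof.
apply/integrableP; split.
  by apply/measurable_EFinP; exact: measurable_tent.
under eq_integral do rewrite /= ger0_norm ?tent_ge0//.
by apply: le_lt_trans integral_tent_le _; rewrite ltry.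
Qed.

End tent.

(** * The fractional seminorm of the tents *)

Section tent_seminorm_bound.
Context (R : realType) (n : nat).
Local Notation E := (euclidean R n).
Local Notation mu := (lebesgue R n).

Lemma integral_close_pairs_series (L a q : R) (c r : nat -> R) :
  0 <= L -> (forall j, 0 <= c j) -> (forall j, 0 <= r j) ->
  0 <= a -> 0 <= q -> q < 1 ->
  (forall j, c j * (2 * r j) ^+ n <= a * q ^+ j) ->
  (\int[mu \x mu]_z \sum_(0 <= j <oo)
      (c j * \1_(close_pairs L (r j) : set (E * E)) z)%:E <=
   (2 * (2 * L) ^+ n * a / (1 - q))%:E)%E.
Proof.
move=> L0 c0 r0 a0 q0 q1 cr.
have m1 j : measurable_fun setT
    (fun z : E * E => (\1_(close_pairs L (r j) : set (E * E)) z : R)%:E).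
  by apply/measurable_EFinP/measurable_indic; exact: measurable_close_pairs.
rewrite integral_nneseries; [|by []| |].
- apply: geometric_eseries_le => // [|j].
    by rewrite mulr_ge0// mulr_ge0// exprn_ge0// mulr_ge0.
  apply/andP; split.
    by apply: integral_ge0 => z _; rewrite lee_fin mulr_ge0.
  under eq_integral do rewrite EFinM.
  rewrite ge0_integralZl_EFin; [|by []|by []|exact: m1|exact: c0].
  rewrite integral_indic; [|by []|exact: measurable_close_pairs].
  rewrite setIT; apply: (@le_trans _ _
      ((c j)%:E * (2 * ((2 * L) ^+ n * (2 * r j) ^+ n))%:E)%E).
    by rewrite lee_wpmul2l ?lee_fin//; exact: close_pairs_measure_le.
  rewrite -EFinM lee_fin.
  have -> : c j * (2 * ((2 * L) ^+ n * (2 * r j) ^+ n)) =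
      2 * (2 * L) ^+ n * (c j * (2 * r j) ^+ n) by ring.
  by rewrite -[leRHS]mulrA ler_wpM2l// mulr_ge0// exprn_ge0// mulr_ge0.
- move=> j; apply/measurable_EFinP; apply: measurable_funM.
    exact: measurable_cst.
  by apply/measurable_indic; exact: measurable_close_pairs.
- by move=> j z _; rewrite lee_fin mulr_ge0.
Qed.

Lemma powR2_gt1 (x : R) : 0 < x -> 1 < 2 `^ x :> R.
Proof.
move=> x0; have := @gt0_ltr_powR _ _ x0 1 2.
by rewrite powR1 !nnegrE; apply => //; lra.
Qed.

Lemma le_term_close_pairs_series (L : R) (c r : nat -> R) (z : E * E) j :
  (forall j, 0 <= c j) -> close_pairs L (r j) z ->
  ((c j)%:E <= \sum_(0 <= k <oo) (c k * \1_(close_pairs L (r k) : set (E * E)) z)%:E)%E.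
Proof.
move=> c0 zj; apply: le_trans (nneseries_lim_ge j.+1 _) => [|k _ _].
  rewrite big_nat_recr//= indicE mem_set// mulr1 leeDr// sume_ge0// => k _.
  by rewrite lee_fin mulr_ge0.
by rewrite lee_fin mulr_ge0.
Qed.

(** The integral of the kernel over y is at most a constant times L^-alpha for
    each x, and x or y is confined to a cube of volume (2 L)^n. The far shells
    contribute a geometric series of ratio 2^-alpha, the near ones a series of
    ratio 2^(alpha - 1): the weights s^-alpha grow like 2^(j alpha) as s
    decreases, and the Lipschitz bound gains the factor 2^-j. *)
Lemma tent_seminorm (alpha : R) : (1 <= n)%N -> 0 < alpha -> alpha < 1 ->
  exists2 C, 0 <= C & forall L, 0 < L ->
  (\int[mu \x mu]_z
    (`|tent L z.1 - tent L z.2| / eucl_dist z.1 z.2 `^ (n%:R + alpha))%:E <=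
   (C * ((2 * L) ^+ n * L `^ (- alpha)))%:E)%E.
Proof.
move=> n1 alpha0 alpha1; set p := n%:R + alpha.
have p_gt0 : 0 < p by rewrite ltr_wpDl.
(* q1 and q2 are the ratios of the far and near series; b = 2 ^ alpha *)
pose q1 : R := 2 `^ (- alpha); pose b : R := 2^-1 `^ (- alpha).
pose q2 : R := 2^-1 * b.
have q1_ge0 : 0 <= q1 by exact: powR_ge0.
have q1_lt1 : q1 < 1 by rewrite /q1 powRN invf_lt1 ?powR2_gt1// powR_gt0.
have b_ge0 : 0 <= b by exact: powR_ge0.
have q2_ge0 : 0 <= q2 by rewrite mulr_ge0.
have q2_lt1 : q2 < 1.
  have b_eq : b = 2 `^ alpha.
    by rewrite /b -[2^-1]powR_inv1// -powRrM mulN1r opprK.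
  have two_eq : (2 : R) = 2 `^ alpha * 2 `^ (1 - alpha).
    rewrite -powRD; last by rewrite pnatr_eq0 implybT.
    by rewrite subrKC powRr1.
  have h1 : 1 < 2 `^ (1 - alpha) :> R by apply: powR2_gt1; lra.
  have h2 : 0 < 2 `^ alpha :> R by rewrite powR_gt0.
  have h3 : 2 `^ alpha < 2 `^ alpha * 2 `^ (1 - alpha) :> R by rewrite ltr_pMr.
  by rewrite /q2 b_eq; rewrite -two_eq in h3; lra.
pose K : R := n%:R * 4 ^+ n.
have K0 : 0 <= K by rewrite mulr_ge0// exprn_ge0.
exists (2 * K * (1 / (1 - q1) + b / (1 - q2))).
  by rewrite mulr_ge0 ?addr_ge0 ?divr_ge0 ?mulr_ge0// subr_ge0 ltW.
move=> L L0.
(* scales and weights of the far shells (index 1) and near shells (index 2) *)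
pose s1 j : R := L * 2 ^+ j; pose s2 j : R := L * 2^-1 ^+ j.+1.
have s1_gt0 j : 0 < s1 j by rewrite mulr_gt0// exprn_gt0.
have s2_gt0 j : 0 < s2 j by rewrite mulr_gt0// exprn_gt0// invr_gt0.
pose c1 j : R := n%:R * (s1 j `^ p)^-1.
pose c2 j : R := n%:R * (2^-1 ^+ j * (s2 j `^ p)^-1).
have c1_ge0 j : 0 <= c1 j by rewrite mulr_ge0// invr_ge0 powR_ge0.
have c2_ge0 j : 0 <= c2 j.
  by rewrite mulr_ge0// mulr_ge0 ?invr_ge0 ?powR_ge0// exprn_ge0// invr_ge0.
pose S (c s : nat -> R) (z : E * E) : \bar R :=
  (\sum_(0 <= j <oo) (c j * \1_(close_pairs L (2 * s j) : set (E * E)) z)%:E)%E.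
have S_ge0 c s z : (forall j, 0 <= c j) -> (0 <= S c s z)%E.
  by move=> c0; apply: nneseries_ge0 => j _ _; rewrite lee_fin mulr_ge0.
have mS c s : (forall j, 0 <= c j) -> measurable_fun setT (S c s).
  move=> c0; apply: ge0_emeasurable_sum => [j z _ _|j _].
    by rewrite lee_fin mulr_ge0.
  apply/measurable_EFinP; apply: measurable_funM; first exact: measurable_cst.
  by apply/measurable_indic; exact: measurable_close_pairs.
apply: (@le_trans _ _ (\int[mu \x mu]_z (S c1 s1 z + S c2 s2 z))%E).
  apply: le_integral_dominated => z _; apply/andP; split.
    by rewrite lee_fin divr_ge0// powR_ge0.
  have [->|vz] := eqVneq (tent L z.1) (tent L z.2).
    by rewrite subrr normr0 mul0r adde_ge0// S_ge0.
  have lip := tent_lipschitz L0 z.1 z.2 n1.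
  (* at distance 0 the Lipschitz bound would force equal values *)
  have d_gt0 : 0 < eucl_dist z.1 z.2.
    rewrite lt_neqAle eucl_dist_ge0 andbT; apply/eqP => d0.
    move: lip; rewrite -d0 mul0r (min_idPr _)// mulr0 normr_le0 subr_eq0.
    by rewrite (negbTE vz).
  have supp : cube (nseq_tuple n (0 : R)) L z.1 \/ cube (nseq_tuple n (0 : R)) L z.2.
    have [|z1] := pselect (cube (nseq_tuple n (0 : R)) L z.1); first by left.
    have [|z2] := pselect (cube (nseq_tuple n (0 : R)) L z.2); first by right.
    by move: vz; rewrite !tent_supp// eqxx.
  have Vp : 0 <= (eucl_dist z.1 z.2 `^ p)^-1 by rewrite invr_ge0 powR_ge0.
  have {}lip := ler_wpM2r Vp lip; rewrite -mulrA in lip.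
  have n0 : (0 : R) <= n%:R by [].
  have [j [[dj wj]|[dj wj]]] := dyadic_radial_bound (ltW p_gt0) L0 d_gt0.
    apply: (@le_trans _ _ (S c1 s1 z)); last by rewrite leeDl// S_ge0.
    apply: (@le_trans _ _ (c1 j)%:E).
      by rewrite lee_fin (le_trans lip)// ler_wpM2l.
    apply: (@le_term_close_pairs_series L c1 (fun k => 2 * s1 k) z j) => //.
    by split => //; exact: eucl_dist_cube.
  apply: (@le_trans _ _ (S c2 s2 z)); last by rewrite leeDr// S_ge0.
  apply: (@le_trans _ _ (c2 j)%:E).
    by rewrite lee_fin (le_trans lip)// ler_wpM2l.
  apply: (@le_term_close_pairs_series L c2 (fun k => 2 * s2 k) z j) => //.
  by split => //; exact: eucl_dist_cube.
rewrite ge0_integralD; [|by []| | | |]; last 4 first.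
- by move=> z _; exact: S_ge0.
- exact: mS.
- by move=> z _; exact: S_ge0.
- exact: mS.
have La : 0 <= L `^ (- alpha) by exact: powR_ge0.
have -> : 2 * K * (1 / (1 - q1) + b / (1 - q2)) * ((2 * L) ^+ n * L `^ (- alpha)) =
    2 * (2 * L) ^+ n * (K * L `^ (- alpha)) / (1 - q1) +
    2 * (2 * L) ^+ n * (K * L `^ (- alpha) * b) / (1 - q2) by ring.
rewrite EFinD; apply: leeD; apply: integral_close_pairs_series => //.
- exact: ltW.
- by move=> j; rewrite mulr_ge0// ltW.
- exact: mulr_ge0.
- move=> j; rewrite /c1 /p -[leLHS]mulrA shell_mass// /s1.
  rewrite powRM ?(ltW L0) ?exprn_ge0// powR_exprn// -/q1.
  by rewrite /K !mulrA.
- exact: ltW.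
- by move=> j; rewrite mulr_ge0// ltW.
- by rewrite mulr_ge0// mulr_ge0.
- move=> j; rewrite /c2 /p [n%:R * (_ * _)]mulrA -[leLHS]mulrA shell_mass// /s2.
  rewrite powRM ?(ltW L0)//.
  rewrite powR_exprn ?invr_ge0// -/b /K /q2 exprS exprMn.
  by rewrite le_eqVlt; apply/orP; left; apply/eqP; ring.
Qed.

End tent_seminorm_bound.

(** * The pairing with a bounded kernel *)

Section pairing.
Context (R : realType) (n : nat).
Local Notation E := (euclidean R n).
Local Notation mu := (lebesgue R n).

Lemma measurable_eucl_dist :
  measurable_fun setT (fun z : E * E => eucl_dist z.1 z.2).
Proof.
rewrite (_ : (fun z : E * E => _) = (fun z : E * E =>
    (\sum_(i < n) (tnth z.1 i - tnth z.2 i) ^+ 2) `^ 2^-1)); last first.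
  by apply/funext => z; rewrite powR12_sqrt// sumr_ge0// => i _; exact: sqr_ge0.
apply: (measurableT_comp (measurable_powR 2^-1)).
apply: measurable_sum => i; apply: measurable_funX; apply: measurable_funB.
  exact: (measurableT_comp (@measurable_coord R n i) measurable_fst).
exact: (measurableT_comp (@measurable_coord R n i) measurable_snd).
Qed.

Lemma measurable_difference_quotient (p : R) (v : E -> R) :
  measurable_fun setT v ->
  measurable_fun setT
    (fun z : E * E => (`|v z.1 - v z.2| / eucl_dist z.1 z.2 `^ p)%:E).
Proof.
move=> mv; apply/measurable_EFinP.
rewrite (_ : (fun z : E * E => _) = (fun z : E * E =>
    `|v z.1 - v z.2| * eucl_dist z.1 z.2 `^ (- p))); last first.
  by apply/funext => z; rewrite powRN.
apply: measurable_funM.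
  apply: (measurableT_comp (@normr_measurable R setT)); apply: measurable_funB.
    exact: (measurableT_comp mv measurable_fst).
  exact: (measurableT_comp mv measurable_snd).
exact: (measurableT_comp (measurable_powR _) measurable_eucl_dist).
Qed.

Lemma Hpairing_le (alpha B : R) (u v : E -> R) : (1 <= n)%N -> 0 < alpha ->
  measurable_fun setT v ->
  (\int[mu \x mu]_z
     (`|v z.1 - v z.2| / eucl_dist z.1 z.2 `^ (n%:R + alpha))%:E <= B%:E)%E ->
  `|Hpairing alpha u v| <= pi * B.
Proof.
move=> n1 alpha0 mv vB; rewrite /Hpairing /Rintegral.
set F := (X in fine X).
have F_le : (`|F| <= (pi * B)%:E)%E.
  apply: (@le_trans _ _ (\int[mu \x mu]_z (pi%:E *
      (`|v z.1 - v z.2| / eucl_dist z.1 z.2 `^ (n%:R + alpha))%:E))%E).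
    apply: abse_integral_le => z _; rewrite -EFinM /= lee_fin.
    rewrite !normrM normfV (ger0_norm (powR_ge0 _ _)) mulrA.
    rewrite ler_wpM2r ?invr_ge0 ?powR_ge0//.
    by rewrite ler_wpM2r// kernelG_bounded.
  rewrite ge0_integralZl_EFin; [|by []| | |exact: pi_ge0].
  - by rewrite EFinM lee_wpmul2l// lee_fin pi_ge0.
  - by move=> z _; rewrite lee_fin divr_ge0// powR_ge0.
  - exact: measurable_difference_quotient.
have Ffin : F \is a fin_num.
  by rewrite -abse_fin_num ge0_fin_numE// (le_lt_trans F_le)// ltry.
by rewrite -lee_fin -abse_EFin fineK.
Qed.

End pairing.

(** With e = |h| / (M + 1), the value L = e^(- 1 / alpha) turns the bound into
    |h| <= M e < |h| unless h = 0. *)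
Lemma eq0_of_le_powRN (R : realType) (alpha M h : R) : 0 < alpha -> 0 <= M ->
  (forall L, 0 < L -> `|h| <= M * L `^ (- alpha)) -> h = 0.
Proof.
move=> alpha0 M0 hM; apply/eqP; apply: contraT => h0.
have h_gt0 : 0 < `|h| by rewrite normr_gt0.
pose e := `|h| / (M + 1).
have M1 : 0 < M + 1 by rewrite ltr_wpDl.
have e0 : 0 < e by rewrite divr_gt0.
have := hM (e `^ (- alpha^-1)) (powR_gt0 _ e0).
rewrite -powRrM mulrNN mulVf ?gt_eqF// (powRr1 (ltW e0)).
have he : `|h| = (M + 1) * e by rewrite /e mulrC divfK// gt_eqF.
by rewrite he mulrDl mul1r gerDl leNgt e0.
Qed.

Theorem proposition7p1 (R : realType) (n : nat) (alpha : R)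
    (u : euclidean R n -> R) (h : R) :
  (1 <= n)%N -> 0 < alpha -> alpha < 1 ->
  weak_solution alpha u h -> h = 0.
Proof.
move=> n1 alpha0 alpha1 [_ sol].
(* |h| (L / n)^n / 2 <= |h| int v_L <= pi C (2 L)^n L^-alpha, for every L *)
have [C C0 HC] := @tent_seminorm R n alpha n1 alpha0 alpha1.
have n0 : 0 < n%:R :> R by rewrite ltr0n.
apply: (@eq0_of_le_powRN R alpha (2 * (2 * n%:R) ^+ n * pi * C)) => //.
  by rewrite !mulr_ge0 ?exprn_ge0 ?pi_ge0 ?mulr_ge0.
move=> L L0; have semi := HC L L0.
have tent_frac : fracSobolev alpha (@tent R n L).
  by split; [exact: integrable_tent|exact: le_lt_trans semi (ltry _)].
have := Hpairing_le u n1 alpha0 (measurable_tent L) semi.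
rewrite (sol _ tent_frac) normrM.
have I_fin : (\int[lebesgue R n]_x (tent L x)%:E)%E \is a fin_num.
  rewrite ge0_fin_numE; last first.
    by apply: integral_ge0 => x _; rewrite lee_fin tent_ge0.
  exact: le_lt_trans (integral_tent_le n L0) (ltry _).
have I_ge : 2^-1 * (L / n%:R) ^+ n <= \int[lebesgue R n]_x tent L x.
  by rewrite /Rintegral -lee_fin fineK//; exact: integral_tent_ge.
have low_gt0 : 0 < 2^-1 * (L / n%:R) ^+ n.
  by rewrite mulr_gt0 ?invr_gt0// exprn_gt0// divr_gt0.
rewrite (ger0_norm (le_trans (ltW low_gt0) I_ge)) => hI.
rewrite -(ler_pM2r low_gt0) (le_trans _ (le_trans hI _))//.
  by rewrite ler_wpM2l.
rewrite le_eqVlt; apply/orP; left; apply/eqP.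
rewrite !exprMn exprVn.
have nn0 : n%:R ^+ n != 0 :> R by rewrite expf_neq0 ?gt_eqF.
by field.
Qed.
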